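(* For all constants $0<c_1\le c_2$ there exists a constant $C>0$, depending only on $c_1,c_2$, such that the following holds. Let $\mathcal{M}_0=(\mathcal{S},\mathcal{A},P,C_0,\gamma)$ be a Markov Decision Process with discount factor $\gamma\in(0,1)$, let $v$ be any initial state distribution on $\mathcal{S}$, let $\pi^*$ be an optimal policy of $\mathcal{M}_0$ with value function $V^*=V^{\pi^*}_{\mathcal{M}_0}$, let $\epsilon>0$, and let $\hat{V}^e:\mathcal{S}\to\mathbb{R}$ satisfy $$c_1\epsilon\le|\hat{V}^e(s)-V^*(s)|\le c_2\epsilon\quad\text{for all } s\in\mathcal{S}$$ (i.e. $|\hat V^e(s)-V^*(s)|=\Theta(\epsilon)$ for all $s$). Let $k>1$ be an integer, and let $\hat{\pi}^*$ be a stationary policy which, simultaneously for every state $s\in\mathcal{S}$, minimizes over all stationary policies $\pi$ the $k$-step disadvantage $$\mathbb{E}\Big[\sum_{i=1}^{k}\gamma^{i-1}c(s_i,a_i)+\gamma^{k}\hat{V}^e(s_{k+1})-\hat{V}^e(s_1)\,\Big|\,s_1=s;\ a\sim\pi\Big].$$ Then $$J(\hat{\pi}^* )-J(\pi^* )\;\leq\; C\,\frac{\gamma^k}{1-\gamma^k}\,\epsilon .$$ (That is, $J(\hat\pi^* )-J(\pi^* )\le O\big(\tfrac{\gamma^k}{1-\gamma^k}\epsilon\big)$.)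
   Context: A (discounted, infinite-horizon, cost-based) Markov Decision Process is $\mathcal{M}_0=(\mathcal{S},\mathcal{A},P,C_0,\gamma)$, where $\mathcal{S}$ is a discrete (finite or countably infinite) set of states, $\mathcal{A}$ is a finite set of actions, $P(s'|s,a)$ is the probability of transitioning to $s'$ from $s$ under action $a$ (write $P_{sa}=P(\cdot|s,a)$), the cost $c(s,a)$ is sampled from a distribution $C_0(s,a)$ with mean $\bar c(s,a)$, where $\bar c$ is bounded, and $\gamma\in(0,1)$ is the discount factor. A stationary stochastic policy $\pi(a|s)$ gives the probability of choosing action $a$ at state $s$. The notation ''$a\sim\pi$'' in an expectation means the trajectory is generated by $a_i\sim\pi(\cdot|s_i)$, $s_{i+1}\sim P_{s_ia_i}$. The value function (expected discounted total cost) of $\pi$ is $V^{\pi}_{\mathcal{M}_0}(s)=\mathbb{E}\big[\sum_{t=0}^{\infty}\gamma^t c(s_t,a_t)\,\big|\,s_0=s,\ a\sim\pi\big]$. An optimal policy $\pi^*$ is a stationary policy minimizing $V^{\pi}_{\mathcal{M}_0}(s)$ over $\pi$ simultaneously for all $s\in\mathcal{S}$. For an initial state distribution $v$ on $\mathcal{S}$, the performance of $\pi$ is $J(\pi)=\mathbb{E}_{s_0\sim v}[V^{\pi}_{\mathcal{M}_0}(s_0)]$. *)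

(* Defs.v *)
From HB Require Import structures.
From mathcomp Require Import all_boot all_order all_algebra.
From mathcomp Require Import all_classical all_reals all_analysis measurable_realfun.

Set Implicit Arguments.
Unset Strict Implicit.
Unset Printing Implicit Defensive.

Import Order.TTheory GRing.Theory Num.Theory.
Import numFieldNormedType.Exports.

Local Open Scope classical_set_scope.
Local Open Scope ring_scope.

Definition discrete_sigma_algebra d (T : measurableType d) : Prop :=
  forall X : set T, measurable X.

Record mdp (R : realType) dS (S : measurableType dS)
    dA (A : measurableType dA) := MDP {
  transition : S -> A -> probability S R;
  cost_dist : S -> A -> probability R R;
  discount : R;
  states_countable : countable [set: S];
  states_discrete : discrete_sigma_algebra S;
  actions_finite : finite_set [set: A];
  actions_discrete : discrete_sigma_algebra A;
  discount_gt0 : 0 < discount;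
  discount_lt1 : discount < 1;
  cost_integrable : forall s a,
    (cost_dist s a).-integrable [set: R] EFin;
  mean_cost_bounded : exists B : R, forall s a,
    `|\int[cost_dist s a]_c c|%R <= B }.

Definition policy (R : realType) dS (S : measurableType dS)
  dA (A : measurableType dA) := S -> probability A R.

(* [cylinder n h] fixes the first n entries. *)
Definition cylinder (X : Type) (n : nat) (h : nat -> X) : set (nat -> X) :=
  [set w | forall i, (i < n)%N -> w i = h i].

Definition cylinders (X : pointedType) : set (set (nat -> X)) :=
  [set C | exists n h, C = cylinder n h].

(* nat -> X with the sigma-algebra generated by the cylinders. *)
Definition traj (X : pointedType) := g_sigma_algebraType (@cylinders X).

(* Chained interval subdivision: given, for each finite history, a partition
   of [0, 1[ into intervals of prescribed lengths indexed by X, a uniformly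
   distributed point of [0, 1[ determines a random sequence in X. *)
Section PathLaw.
Context (R : realType) d (X : measurableType d).
Variables (left len : seq X -> X -> R).
Hypothesis len_ge0 : forall h x, 0 <= len h x.
Hypothesis left_ge0 : forall h x, 0 <= left h x.
Hypothesis right_le1 : forall h x, left h x + len h x <= 1.
Hypothesis cover : forall h u, 0 <= u < 1 ->
  exists x, left h x <= u < left h x + len h x.
Hypothesis disj : forall h u x y, left h x <= u < left h x + len h x ->
  left h y <= u < left h y + len h y -> x = y.

(* (left endpoint, length) of the interval of the reversed history *)
Fixpoint cell (h : seq X) : R * R :=
  if h is x :: h' then
    ((cell h').1 + (cell h').2 * left h' x, (cell h').2 * len h' x)
  else (0, 1).

Definition in_cell (h : seq X) (u : R) : Prop :=
  (cell h).1 <= u < (cell h).1 + (cell h).2.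

Fixpoint hist (u : R) (n : nat) : seq X :=
  if n is n'.+1 then
    xget point [set x | in_cell (x :: hist u n') u] :: hist u n'
  else [::].

Definition letters (u : R) : nat -> X :=
  if (0 <= u < 1) then fun n => head point (hist u n.+1) else fun=> point.

Lemma cell_len_ge0 h : 0 <= (cell h).2.
Proof. by elim: h => [|x h IH] //=; rewrite mulr_ge0. Qed.

Lemma in_cell_cons x h u : in_cell (x :: h) u -> in_cell h u.
Proof.
rewrite /in_cell /= => /andP[h1 h2]; have l0 := cell_len_ge0 h.
apply/andP; split.
  by apply: le_trans h1; rewrite lerDl mulr_ge0.
apply: (lt_le_trans h2); rewrite -addrA -mulrDr lerD2l.
by rewrite ler_piMr.
Qed.

Lemma in_cell_len_gt0 h u : in_cell h u -> 0 < (cell h).2.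
Proof.
by rewrite /in_cell => /andP[h1 h2]; have := le_lt_trans h1 h2; rewrite ltrDl.
Qed.

Lemma in_cell_rescale x h u : 0 < (cell h).2 ->
  in_cell (x :: h) u <->
  left h x <= (u - (cell h).1) / (cell h).2 < left h x + len h x.
Proof.
move=> l0; rewrite /in_cell /= -addrA -mulrDr.
rewrite ler_pdivlMr // ltr_pdivrMr // lerBrDl ltrBlDl.
by rewrite [left h x * _]mulrC [(left h x + _) * _]mulrC.
Qed.

Lemma in_cell_ex h u : in_cell h u -> exists x, in_cell (x :: h) u.
Proof.
move=> hu; have l0 := in_cell_len_gt0 hu.
have [|x hx] := @cover h ((u - (cell h).1) / (cell h).2).
  rewrite divr_ge0 ?(ltW l0) //= ?subr_ge0; last by case/andP: hu.
  by rewrite ltr_pdivrMr // mul1r ltrBlDl; case/andP: hu.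
by exists x; apply/in_cell_rescale.
Qed.

Lemma in_cell_uniq h u x y :
  in_cell (x :: h) u -> in_cell (y :: h) u -> x = y.
Proof.
move=> hx hy; have l0 := in_cell_len_gt0 (in_cell_cons hx).
by apply: (disj (proj1 (in_cell_rescale _ _ l0) hx)); apply/in_cell_rescale.
Qed.

Lemma in_cell_hist u n : 0 <= u < 1 -> in_cell (hist u n) u.
Proof.
move=> u01; elim: n => [|n IH]; first by rewrite /in_cell /= add0r.
by rewrite /=; case: xgetP => [x _ //|no]; have [x /no] := in_cell_ex IH.
Qed.

Lemma size_hist u n : size (hist u n) = n.
Proof. by elim: n => //= n ->. Qed.

Lemma in_cellE u h : 0 <= u < 1 -> in_cell h u <-> hist u (size h) = h.
Proof.
move=> u01; split=> [|<-]; last exact: in_cell_hist.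
elim: h => //= x h IH hx; have eh := IH (in_cell_cons hx).
by rewrite eh; congr cons; apply: (@in_cell_uniq h u) => //;
  have := in_cell_hist (size h).+1 u01; rewrite /= eh.
Qed.

Definition rhist (h : nat -> X) (n : nat) : seq X := rev (mkseq h n).

Lemma rhistS h n : rhist h n.+1 = h n :: rhist h n.
Proof. by rewrite /rhist mkseqS rev_rcons. Qed.

Lemma size_rhist h n : size (rhist h n) = n.
Proof. by rewrite size_rev size_mkseq. Qed.

Lemma letters_cylinder u n h : 0 <= u < 1 ->
  cylinder n h (letters u) <-> in_cell (rhist h n) u.
Proof.
move=> u01; rewrite in_cellE // size_rhist /letters u01 /cylinder.
elim: n => [|n [IH1 IH2]]; first by split.
rewrite rhistS; split=> [H|].
  rewrite -(H n) // -IH1 // => i ni; exact: H (ltnW ni).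
move=> /= [H1 H2] i; rewrite ltnS leq_eqVlt => /orP[/eqP ->//|].
by move: i; apply: IH2.
Qed.

Lemma in_cell01 h u : in_cell h u -> 0 <= u < 1.
Proof.
elim: h => [|x h IH]; first by rewrite /in_cell /= add0r.
by move/in_cell_cons.
Qed.

Lemma letters_preimage n h :
  [set u | cylinder n h (letters u)] `&` `[0, 1[%classic
    = `[(cell (rhist h n)).1, (cell (rhist h n)).1 + (cell (rhist h n)).2[%classic.
Proof.
apply/seteqP; split => u /=; rewrite !in_itv /=.
  by case=> + u01; rewrite letters_cylinder.
by move=> hu; have u01 := in_cell01 hu; rewrite letters_cylinder.
Qed.

Lemma measurable_letters :
  measurable_fun [set: measurableTypeR R]
    (letters : measurableTypeR R -> traj X).
Proof.
apply: (@measurability _ _ (measurableTypeR R) (traj X) setT letters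
  (@cylinders X)) => //.
move=> _ [_ [n [h ->]] <-]; rewrite setTI.
have -> : letters @^-1` cylinder n h =
   ([set u | cylinder n h (letters u)] `&` `[0, 1[%classic) `|`
   ([set u | cylinder n h (fun=> point)] `&` ~` `[0, 1[%classic).
  apply/seteqP; split => u /=; rewrite in_itv /=.
    case: (boolP (0 <= u < 1)) => u01 H; first by left.
    by right; split => //; move: H; rewrite /letters (negbTE u01).
  by case=> [[]//|[H /negP u01]]; rewrite /letters (negbTE u01).
rewrite letters_preimage; apply: measurableU; first exact: measurable_itv.
apply: measurableI; last by apply: measurableC; exact: measurable_itv.
by have [c|c] := pselect (cylinder n h (fun=> point : X));
  [rewrite (_ : [set _ | _] = setT)|rewrite (_ : [set _ | _] = set0)] => //;
  apply/seteqP; split.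
Qed.

Let itv01 : measurable (`[0, 1[%classic : set (measurableTypeR R)).
Proof. exact: measurable_itv. Qed.

Definition unif01 := mrestr (@lebesgue_measure R) itv01.

HB.instance Definition _ := Measure.on unif01.

Let unif01_setT : unif01 [set: _] = 1%E.
Proof.
rewrite /unif01 /mrestr setTI lebesgue_measure_itv /= lte_fin ltr01.
by rewrite sube0.
Qed.

HB.instance Definition _ := Measure_isProbability.Build _ _ _ unif01 unif01_setT.

Lemma path_law_exists : exists mu : probability (traj X) R,
  forall n h, mu (cylinder n h) = (\prod_(i < n) len (rhist h i) (h i))%:E.
Proof.
pose L : {mfun measurableTypeR R >-> traj X} := mfun_Sub (mem_set measurable_letters).
exists (distribution unif01 L) => n h.
have E : (cell (rhist h n)).2 = \prod_(i < n) len (rhist h i) (h i).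
  elim: n => [|n IH]; first by rewrite big_ord0.
  by rewrite rhistS /= big_ord_recr /= IH.
rewrite /distribution /pushforward /= /unif01 /mrestr /preimage /=.
rewrite letters_preimage lebesgue_measure_itv /= lte_fin E ltrDl.
have [//|] := ltrP 0 (\prod_(i < n) len (rhist h i) (h i)).
  by rewrite -EFinD addrAC subrr add0r.
by move=> p0; congr EFin; apply/esym/eqP; rewrite eq_le p0 prodr_ge0.
Qed.

End PathLaw.

Section Partition.
Context (R : realType) d (T : measurableType d) (mu : probability T R).
Variable e : T -> nat.
Hypothesis e_inj : injective e.
Hypothesis Tdisc : discrete_sigma_algebra T.

Definition pmass (x : T) : R := fine (mu [set x]).
Definition pcum (n : nat) : R := fine (mu [set y | (e y < n)%N]).

Let pfin A : mu A \is a fin_num.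
Proof. exact/fin_num_measure/Tdisc. Qed.

Lemma pmass_ge0 x : 0 <= pmass x.
Proof. by rewrite fine_ge0. Qed.

Lemma pcum_ge0 n : 0 <= pcum n.
Proof. by rewrite fine_ge0. Qed.

Lemma pcum_le1 n : pcum n <= 1.
Proof. by rewrite -lee_fin fineK // probability_le1 //; exact: Tdisc. Qed.

Lemma pcum0 : pcum 0 = 0.
Proof.
rewrite /pcum (_ : [set _ | _] = set0) ?measure0 //.
by apply/seteqP; split.
Qed.

Lemma pcum_homo m n : (m <= n)%N -> pcum m <= pcum n.
Proof.
move=> mn; rewrite fine_le // le_measure ?inE //; try exact: Tdisc.
by move=> y /= /leq_trans; apply.
Qed.

Lemma pcumS x : pcum (e x) + pmass x = pcum (e x).+1.
Proof.
apply: EFin_inj; rewrite EFinD !fineK // -measureU; try exact: Tdisc.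
  congr (mu _); apply/seteqP; split=> y /=.
    by case=> [/ltnW|->].
  by rewrite ltnS leq_eqVlt => /orP[/eqP/e_inj ->|]; [right|left].
by apply/seteqP; split=> y //= [h ye]; move: h; rewrite ye ltnn.
Qed.

Lemma pcum_step m : pcum m < pcum m.+1 -> exists x, e x = m.
Proof.
move=> lt; have [//|no] := pselect (exists x, e x = m).
move: lt; rewrite /pcum (_ : [set y | (e y < m.+1)%N] = [set y | (e y < m)%N]).
  by rewrite ltxx.
apply/seteqP; split=> y /=; last by move/ltnW.
by rewrite ltnS leq_eqVlt => /orP[/eqP ym|//]; case: no; exists y.
Qed.

Lemma pcum_cvg : (fun n => (pcum n)%:E) @ \oo --> (1%:E : \bar R).
Proof.
rewrite -(probability_setT mu).
have -> : [set: T] = \bigcup_n [set y | (e y < n)%N].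
  by apply/seteqP; split=> y // _; exists (e y).+1 => /=.
rewrite (_ : (fun _ => _) = mu \o (fun n => [set y | (e y < n)%N])); last first.
  by apply/funext => n /=; rewrite fineK.
apply: nondecreasing_cvg_mu; try by move=> *; exact: Tdisc.
move=> m n mn; apply/subsetPset => y /= ym; exact: leq_trans mn.
Qed.

Lemma pcum_cover u : 0 <= u < 1 -> exists x, pcum (e x) <= u < pcum (e x) + pmass x.
Proof.
move=> /andP[u0 u1].
have exN : exists n, u < pcum n.
  have [//|no] := pselect (exists n, u < pcum n).
  have : (1%:E <= u%:E :> \bar R)%E.
    rewrite -(cvg_lim _ pcum_cvg) //; apply: lime_le.
      by apply/cvg_ex; exists 1%:E; exact: pcum_cvg.
    apply: nearW => n; rewrite lee_fin leNgt; apply/negP => h.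
    by apply: no; exists n.
  by rewrite lee_fin leNgt u1.
case: (ex_minnP exN) => -[|m] hm min_m.
  by move: hm; rewrite pcum0 ltNge u0.
have um : pcum m <= u.
  by rewrite leNgt; apply/negP => /min_m; rewrite ltnn.
have [x xm] := pcum_step (le_lt_trans um hm).
by exists x; rewrite pcumS xm um.
Qed.

Lemma pcum_disj u x y : pcum (e x) <= u < pcum (e x) + pmass x ->
  pcum (e y) <= u < pcum (e y) + pmass y -> x = y.
Proof.
rewrite !pcumS => /andP[x1 x2] /andP[y1 y2]; apply: e_inj.
have [xy|yx|//] := ltngtP (e x) (e y).
  by have := lt_le_trans x2 (le_trans (pcum_homo xy) y1); rewrite ltxx.
by have := lt_le_trans y2 (le_trans (pcum_homo yx) x1); rewrite ltxx.
Qed.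

End Partition.

Definition mean_cost (R : realType) dS (S : measurableType dS)
    dA (A : measurableType dA) (M : mdp R S A) (x : S * A) : R :=
  \int[cost_dist M x.1 x.2]_c c.

(* s_0 = s, a_t ~ pi(.|s_t), s_(t+1) ~ P(.|s_t, a_t). *)
Definition is_traj_law (R : realType) dS (S : measurableType dS)
    dA (A : measurableType dA) (M : mdp R S A) (pi : policy R S A) (s : S)
    (mu : probability (traj (S * A)%type) R) : Prop :=
  forall n (h : nat -> S * A),
    mu (cylinder n.+1 h) =
    (\d_s [set (h 0%N).1] * pi (h 0%N).1 [set (h 0%N).2] *
     \prod_(i < n) (transition M (h i).1 (h i).2 [set (h i.+1).1] *
                    pi (h i.+1).1 [set (h i.+1).2]))%E.

Section TrajLaw.
Context (R : realType) dS (S : measurableType dS) dA (A : measurableType dA).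
Variables (M : mdp R S A) (pi : policy R S A) (s : S).

Let next_state (h : seq (S * A)) : probability S R :=
  if h is x :: _ then transition M x.1 x.2 else \d_s.

Lemma traj_law_exists : exists mu, is_traj_law M pi s mu.
Proof.
have Sd := states_discrete M; have Ad := actions_discrete M.
have /countable_injP[eS /in2TT eSi] := states_countable M.
have /countable_injP[eA /in2TT eAi] := finite_set_countable (actions_finite M).
pose len h x := pmass (next_state h) x.1 * pmass (pi x.1) x.2.
pose left h x := pcum (next_state h) eS (eS x.1) +
  pmass (next_state h) x.1 * pcum (pi x.1) eA (eA x.2).
have len0 h x : 0 <= len h x by rewrite mulr_ge0 // pmass_ge0.
have left0 h x : 0 <= left h x.
  by rewrite addr_ge0 ?mulr_ge0 ?pcum_ge0 ?pmass_ge0.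
have inner (h : seq (S * A)) (x : S) (a : A) u :
  left h (x, a) <= u < left h (x, a) + len h (x, a) ->
  0 < pmass (next_state h) x /\
  pcum (pi x) eA (eA a) <= (u - pcum (next_state h) eS (eS x)) / pmass (next_state h) x
    < pcum (pi x) eA (eA a) + pmass (pi x) a.
  rewrite /left /len /= => /andP[u1 u2].
  have p0 : 0 < pmass (next_state h) x.
    rewrite lt_neqAle pmass_ge0 andbT eq_sym; apply/eqP => p0.
    by move: (le_lt_trans u1 u2); rewrite p0 !mul0r !addr0 ltxx.
  split=> //; rewrite ler_pdivlMr // ltr_pdivrMr // lerBrDl ltrBlDl.
  by rewrite mulrDl addrA ![_ * pmass (next_state h) x]mulrC u1 u2.
have outer (h : seq (S * A)) (x : S) (a : A) u :
  left h (x, a) <= u < left h (x, a) + len h (x, a) ->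
  pcum (next_state h) eS (eS x) <= u
    < pcum (next_state h) eS (eS x) + pmass (next_state h) x.
  rewrite /left /len /= => /andP[u1 u2]; apply/andP; split.
    by apply: le_trans u1; rewrite lerDl mulr_ge0 ?pcum_ge0 ?pmass_ge0.
  apply: (lt_le_trans u2); rewrite -addrA -mulrDr lerD2l.
  by rewrite ler_piMr ?pmass_ge0 // pcumS // pcum_le1.
have right1 h x : left h x + len h x <= 1.
  rewrite /left /len -addrA -mulrDr pcumS //.
  apply: (@le_trans _ _ (pcum (next_state h) eS (eS x.1) + pmass (next_state h) x.1)).
    by rewrite lerD2l ler_piMr ?pmass_ge0 // pcum_le1.
  by rewrite pcumS // pcum_le1.
have cov h u : 0 <= u < 1 -> exists x, left h x <= u < left h x + len h x.
  move=> u01; have [x /andP[x1 x2]] := pcum_cover (next_state h) eSi Sd u01.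
  have p0 : 0 < pmass (next_state h) x by have := le_lt_trans x1 x2; rewrite ltrDl.
  have [|a] := @pcum_cover _ _ _ (pi x) eA eAi Ad
      ((u - pcum (next_state h) eS (eS x)) / pmass (next_state h) x).
    by rewrite divr_ge0 ?(ltW p0) ?subr_ge0 //= ltr_pdivrMr // mul1r ltrBlDl.
  rewrite ler_pdivlMr // ltr_pdivrMr // lerBrDl ltrBlDl mulrDl addrA.
  by rewrite ![_ * pmass (next_state h) x]mulrC; exists (x, a).
have dis h u x y : left h x <= u < left h x + len h x ->
    left h y <= u < left h y + len h y -> x = y.
  case: x y => [x a] [y b] hx hy.
  have xy : x = y by apply: (pcum_disj eSi Sd (outer _ _ _ _ hx) (outer _ _ _ _ hy)).
  rewrite -{}xy in hy *; congr pair.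
  by apply: (pcum_disj eAi Ad (inner _ _ _ _ hx).2 (inner _ _ _ _ hy).2).
have [mu mulaw] := path_law_exists len0 left0 right1 cov dis.
exists mu => n h; rewrite mulaw.
rewrite big_ord_recl /= EFinM -prodEFin /len /= EFinM.
have pE (mu' : probability S R) x : (pmass mu' x)%:E = mu' [set x].
  by rewrite fineK // fin_num_measure //; exact: Sd.
have qE (mu' : probability A R) x : (pmass mu' x)%:E = mu' [set x].
  by rewrite fineK // fin_num_measure //; exact: Ad.
rewrite pE qE /=; congr (_ * _)%E; apply: eq_bigr => i _.
by rewrite EFinM pE qE /= rhistS.
Qed.

Definition traj_law : probability (traj (S * A)%type) R :=
  sval (cid traj_law_exists).

Lemma traj_lawP : is_traj_law M pi s traj_law.
Proof. exact: svalP (cid traj_law_exists). Qed.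

(* The stage cost enters through its conditional mean given (s_t, a_t): only
   the means are assumed bounded, so a return built from sampled costs need not
   be integrable. When it is absolutely integrable, [sampled_return_value] below
   shows that its expectation is the same number. *)
Definition value : R :=
  \int[traj_law]_w limn (series (fun t => discount M ^+ t * mean_cost M (w t))).

(* Trajectories are indexed from 0: [w i] is (s_(i+1), a_(i+1)) in the usual
   1-based writing of the k-step sum. *)
Definition disadvantage (Vhat : S -> R) (k : nat) : R :=
  \int[traj_law]_w (\sum_(0 <= i < k) discount M ^+ i * mean_cost M (w i)
                   + discount M ^+ k * Vhat (w k).1 - Vhat (w 0%N).1).

End TrajLaw.

Section Optimality.
Context (R : realType) dS (S : measurableType dS) dA (A : measurableType dA).
Variable M : mdp R S A.

Definition optimal_policy (pi : policy R S A) : Prop :=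
  forall (pi' : policy R S A) (s : S), value M pi s <= value M pi' s.

Definition minimizes_disadvantage (Vhat : S -> R) (k : nat)
    (pi : policy R S A) : Prop :=
  forall (pi' : policy R S A) (s : S),
    disadvantage M pi s Vhat k <= disadvantage M pi' s Vhat k.

Definition performance (v : probability S R) (pi : policy R S A) : R :=
  \int[v]_s value M pi s.

End Optimality.

Lemma measurable_prefix d (X : measurableType d) n (C : set (nat -> X)) :
  countable [set: X] ->
  (forall w w', (forall i, (i < n)%N -> w i = w' i) -> C w -> C w') ->
  measurable (C : set (traj X)).
Proof.
move=> /countable_injP[e /in2TT ei] HC.
pose code w := pickle (map e (mkseq w n)).
have codeP (w w' : nat -> X) : code w = code w' -> forall i, (i < n)%N -> w i = w' i.
  move=> /(pcan_inj pickleK) /(inj_map ei) E i ni.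
  by rewrite -(nth_mkseq point w ni) E nth_mkseq.
rewrite (_ : C = \bigcup_m [set w | C w /\ code w = m]); last first.
  by apply/seteqP; split=> [w Cw|w [m _ []//]]; exists (code w).
apply: (@bigcup_measurable _ (traj X)) => m _.
have [[w0 [Cw0 w0m]]|no] := pselect (exists w, C w /\ code w = m); last first.
  rewrite (_ : [set w | C w /\ code w = m] = set0); first exact: (@measurable0 _ (traj X)).
  by apply/seteqP; split=> w // h; case: no; exists w.
apply: sub_sigma_algebra; exists n, w0; apply/seteqP; split=> w /=.
  by move=> [Cw wm] i ni; apply: codeP => //; rewrite wm.
move=> h; split; first by apply: (HC w0) => // i ni; rewrite h.
rewrite -w0m; congr (pickle (map e _)); apply/eq_in_map => i.
by rewrite mem_iota => /andP[_ ?]; exact: h.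
Qed.

Section RestrictedIntegral.
Local Open Scope ereal_scope.
Context (R : realType) d (Omega : measurableType d).
Variables (Q : probability Omega R) (nu : probability R R).
Variables (E : set Omega) (c : Omega -> R) (p : {nonneg R}).
Hypotheses (mE : measurable E) (mc : measurable_fun setT c).
Hypothesis joint : forall B, measurable B ->
  Q (E `&` c @^-1` B) = p%:num%:E * nu B.

Let ge0_restricted (f : R -> \bar R) :
  measurable_fun [set: R] f -> (forall x, 0 <= f x) ->
  \int[Q]_(o in E) f (c o) = p%:num%:E * \int[nu]_x f x.
Proof.
move=> mf f0; have mfc : measurable_fun setT (f \o c) by exact: measurableT_comp.
rewrite -ge0_integral_mscale //.
transitivity (\int[pushforward (mrestr Q mE) c]_x f x); last first.
  apply: eq_measure_integral => B mB _.
  by rewrite -[RHS]joint // /pushforward /mrestr setIC.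
rewrite ge0_integral_pushforward // preimage_setT -(setUv E).
rewrite ge0_integral_setU //=; first last.
- by apply/disj_setPCl.
- exact: measurable_funTS.
- exact: measurableC.
rewrite [X in _ = _ + X](_ : _ = 0) ?adde0.
  apply: eq_measure_integral => A mA AE.
  by rewrite /= /mrestr setIidl.
apply: null_set_integral => //.
- exact: measurableC.
- exact: measurable_funTS.
- by rewrite /= /mrestr setICl measure0.
Qed.

Lemma integral_restricted (f : R -> \bar R) :
  nu.-integrable [set: R] f ->
  \int[Q]_(o in E) f (c o) = p%:num%:E * \int[nu]_x f x.
Proof.
move=> inf; have mf := measurable_int _ inf.
have fp := integrable_pos_fin_num measurableT inf.
have fn := integrable_neg_fin_num measurableT inf.
rewrite integralE [in RHS]integralE muleBr //; last first.
  by rewrite fin_num_adde_defl // fin_numN.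
rewrite -!ge0_restricted //.
- by rewrite (funepos_comp f c) (funeneg_comp f c).
- exact: measurable_funeneg.
- exact: measurable_funepos.
Qed.
End RestrictedIntegral.

Lemma integral_series (R : realType) d (Omega : measurableType d)
    (Q : probability Omega R) (f : nat -> Omega -> R) (g : Omega -> R) :
  (forall t, measurable_fun [set: Omega] (f t)) ->
  measurable_fun [set: Omega] g ->
  (\sum_(0 <= t <oo) \int[Q]_o `|f t o|%:E < +oo)%E ->
  {ae Q, forall o, series (f ^~ o) @ \oo --> g o} ->
  \int[Q]_o g o = limn (series (fun t => \int[Q]_o f t o)).
Proof.
move=> mf mg fin fg.
have mabs t : measurable_fun [set: Omega] (fun o => `|f t o|%:E).
  by apply/measurable_EFinP; exact: measurableT_comp.
have intf t : Q.-integrable [set: Omega] (fun o => (f t o)%:E).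
  apply/integrableP; split; first exact/measurable_EFinP.
  apply: le_lt_trans fin.
  have ge0 k : (0 <= \int[Q]_o `|f k o|%:E)%E.
    by apply: integral_ge0 => o _; rewrite lee_fin.
  apply: le_trans (@nneseries_lim_ge _ _ xpredT 0%N t.+1 _); last first.
    by move=> k _ _; exact: ge0.
  by rewrite big_nat_recr //= leeDr // sume_ge0.
pose dom o := (\sum_(0 <= t <oo) `|f t o|%:E)%E.
have idom : Q.-integrable [set: Omega] dom.
  apply/integrableP; split.
    by apply: (@ge0_emeasurable_sum _ _ _ setT (fun t o => `|f t o|%:E) xpredT).
  rewrite (eq_integral dom).
    by rewrite integral_nneseries.
  by move=> o _; rewrite gee0_abs //; apply: nneseries_ge0.
have [||||ig _ /=] := @dominated_convergence _ _ _ Q setT measurableT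
    (fun n o => (series (f ^~ o) n)%:E) (EFin \o g) dom _ _ _ idom.
- move=> n; apply/measurable_EFinP; rewrite /series /=.
  exact: measurable_sum.
- exact/measurable_EFinP.
- by apply: filterS fg => o h _; apply: cvg_EFin => //; exact: nearW.
- apply: aeW => o n _; rewrite /= /series /=.
  apply: (@le_trans _ _ (\sum_(0 <= t < n) `|f t o|%:E)%E).
    by rewrite sumEFin lee_fin ler_norm_sum.
  exact: nneseries_lim_ge.
move=> cv; apply/esym/cvg_lim => //.
suff : (fun n => (series (fun t => \int[Q]_o f t o) n)%:E) @ \oo -->
    (\int[Q]_o g o)%:E by move/fine_cvg.
rewrite /Rintegral fineK; last exact: integrable_fin_num.
apply: cvg_trans cv; apply: near_eq_cvg; apply: nearW => n.
rewrite /series /= -sumEFin.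
under eq_integral do rewrite -sumEFin.
rewrite integral_sum //; apply: eq_bigr => t _.
by rewrite fineK //; exact: integrable_fin_num.
Qed.

(* An arbitrary probability space carrying state-action pairs [x_ t] and
   sampled costs [c_ t], where [x_ t] has its law under the trajectory measure
   and [c_ t] is drawn from the cost distribution at [x_ t]. *)
Section StageCost.
Context (R : realType) dS (S : measurableType dS) dA (A : measurableType dA).
Variables (M : mdp R S A) (pi : policy R S A) (s : S).
Context d (Omega : measurableType d) (Q : probability Omega R).
Variables (x_ : nat -> Omega -> S * A) (c_ : nat -> Omega -> R).
Hypothesis mx : forall t x, measurable [set o | x_ t o = x].
Hypothesis mc : forall t, measurable_fun setT (c_ t).
Hypothesis joint : forall t x (B : set R), measurable B ->
  Q ([set o | x_ t o = x] `&` c_ t @^-1` B) =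
  (traj_law M pi s [set w | w t = x] * cost_dist M x.1 x.2 B)%E.

Lemma countable_SA : countable [set: S * A].
Proof.
rewrite -setXTT; apply: countableX (states_countable M) _.
exact: finite_set_countable (actions_finite M).
Qed.

Lemma measurable_at t (B : set (S * A)) : measurable ([set w | B (w t)] : set (traj (S * A)%type)).
Proof.
apply: (@measurable_prefix _ (S * A)%type t.+1); first exact: countable_SA.
by move=> w w' h /=; rewrite (h t).
Qed.

Lemma measurable_mean_cost t :
  measurable_fun [set: traj (S * A)%type] (fun w => mean_cost M (w t)).
Proof.
by move=> _ B mB; rewrite setTI; exact: (@measurable_at t (fun x => B (mean_cost M x))).
Qed.

Lemma integrable_mean_cost t :
  (traj_law M pi s).-integrable setT (fun w => (mean_cost M (w t))%:E).
Proof.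
have [B HB] := mean_cost_bounded M.
apply: (@le_integrable _ _ _ _ _ _ _ (cst B%:E)) => //.
- by apply/measurable_EFinP; exact: measurable_mean_cost.
- move=> w _ /=; rewrite lee_fin; apply: le_trans (HB _ _) _; exact: ler_norm.
- exact: finite_measure_integrable_cst.
Qed.

Lemma stage_cost t : Q.-integrable setT (fun o => (c_ t o)%:E) ->
  \int[Q]_o c_ t o = \int[traj_law M pi s]_w mean_cost M (w t).
Proof.
move=> ic; rewrite /Rintegral; congr fine.
have /countable_injP[e /in2TT ei] := countable_SA.
pose F n := [set o | e (x_ t o) = n].
pose G n : set (traj (S * A)%type) := [set w | e (w t) = n].
have mF n : measurable (F n).
  have [[x xn]|no] := pselect (exists x, e x = n).
    rewrite (_ : F n = [set o | x_ t o = x]) //.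
    by apply/seteqP; split=> o; rewrite /F /= -xn; [move/ei|move->].
  rewrite (_ : F n = set0) //; apply/seteqP; split=> o //= h.
  by apply: no; exists (x_ t o).
have mG n : measurable (G n) by exact: (@measurable_at t (fun x => e x = n)).
have UF : \bigcup_n F n = setT.
  by apply/seteqP; split=> o // _; exists (e (x_ t o)).
have UG : \bigcup_n G n = setT.
  by apply/seteqP; split=> w // _; exists (e (w t)).
have tF : trivIset setT F by move=> i j _ _ [w []]; rewrite /F /G /= => <- <-.
have tG : trivIset setT G by move=> i j _ _ [w []]; rewrite /F /G /= => <- <-.
rewrite -[in LHS]UF -[in RHS]UG integral_bigcup ?UF //.
rewrite (@integral_bigcup _ _ _ (traj_law M pi s) G) ?UG //; last first.
  exact: integrable_mean_cost.
apply: eq_eseriesr => n _.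
have [[x xn]|no] := pselect (exists x, e x = n); last first.
  have F0 : F n = set0 by apply/seteqP; split=> o //= h; apply: no; exists (x_ t o).
  have G0 : G n = set0 by apply/seteqP; split=> w //= h; apply: no; exists (w t).
  by rewrite F0 G0 !integral_set0.
have Fx : F n = [set o | x_ t o = x].
  by apply/seteqP; split=> o; rewrite /F /= -xn; [move/ei|move->].
have Gx : G n = [set w | w t = x].
  by apply/seteqP; split=> o; rewrite /G /= -xn; [move/ei|move->].
have mGx : measurable ([set w | w t = x] : set (traj (S * A)%type)) by rewrite -Gx.
have p0 : 0 <= fine (traj_law M pi s [set w | w t = x]) by rewrite fine_ge0.
pose p := NngNum p0.
have pE : (p%:num)%:E = traj_law M pi s [set w | w t = x].
  by rewrite fineK // fin_num_measure.
rewrite Fx (@integral_restricted _ _ _ Q (cost_dist M x.1 x.2) _ (c_ t) p _ _ _ EFin) //; last 2 first.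
- by move=> B mB; rewrite pE joint.
- exact: cost_integrable.
rewrite (eq_integral (cst (mean_cost M x)%:E)); last first.
  by move=> w; rewrite inE Gx /= => ->.
rewrite integral_cst // Gx pE muleC; congr (_ * _)%E.
rewrite /mean_cost /Rintegral fineK //.
by apply: integrable_fin_num => //; exact: cost_integrable.
Qed.

Lemma sampled_return_value (ret : Omega -> R) :
  measurable_fun [set: Omega] ret ->
  (\sum_(0 <= t <oo) \int[Q]_o `|discount M ^+ t * c_ t o|%:E < +oo)%E ->
  {ae Q, forall o, series (fun t => discount M ^+ t * c_ t o) @ \oo --> ret o} ->
  \int[Q]_o ret o = value M pi s.
Proof.
move=> mret fin cvret; pose g := discount M.
have g0 : 0 < g := discount_gt0 M.
have gt0 t : 0 < g ^+ t by rewrite exprn_gt0.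
have icost t : Q.-integrable setT (fun o => (c_ t o)%:E).
  apply/integrableP; split; first exact/measurable_EFinP.
  have : (\int[Q]_o `|g ^+ t * c_ t o|%:E < +oo)%E.
    apply: le_lt_trans fin.
    have ge0 k : (0 <= \int[Q]_o `|g ^+ k * c_ k o|%:E)%E.
      by apply: integral_ge0 => o _; rewrite lee_fin.
    apply: le_trans (@nneseries_lim_ge _ _ xpredT 0%N t.+1 _); last first.
      by move=> k _ _; exact: ge0.
    by rewrite big_nat_recr //= leeDr // sume_ge0.
  under eq_integral do rewrite normrM EFinM (ger0_norm (ltW (gt0 t))).
  rewrite ge0_integralZl //; last first.
  - by rewrite lee_fin ltW.
  - by apply/measurable_EFinP; exact: measurableT_comp.
  by move=> h; rewrite ltNge leye_eq; apply/negP => /eqP h'; move: h; rewrite h' gt0_muley ?lte_fin.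
rewrite (integral_series _ mret fin cvret); last first.
  by move=> t; apply: measurable_funM => //; exact: measurable_cst.
have [B HB] := mean_cost_bounded M.
have gB t (x : S * A) : `|g ^+ t * mean_cost M x| <= B * g ^+ t.
  by rewrite normrM mulrC (ger0_norm (ltW (gt0 t))) ler_pM2r // HB.
have g1 : `|g| < 1 by rewrite ger0_norm ?(ltW g0) // discount_lt1.
have cvB : cvgn (series (fun t => B * g ^+ t)).
  exact: is_cvg_geometric_series.
have cvs (w : nat -> S * A) : cvgn (series (fun t => g ^+ t * mean_cost M (w t))).
  apply: normed_cvg; apply: series_le_cvg cvB => t //=.
  exact: le_trans (gB t (w 0%N)).
have mf t : measurable_fun [set: traj (S * A)%type]
    (fun w => g ^+ t * mean_cost M (w t)).
  by apply: measurable_funM; [exact: measurable_cst|exact: measurable_mean_cost].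
rewrite /value (@integral_series _ _ _ _ (fun t (w : traj (S * A)%type) => g ^+ t * mean_cost M (w t))) //.
- congr (limn (series _)); apply/funext => t.
  rewrite (@RintegralZl _ _ _ Q setT (c_ t) (g ^+ t)) //.
  rewrite (@RintegralZl _ _ _ (traj_law M pi s) setT (fun w => mean_cost M (w t))) //.
    by rewrite stage_cost.
    exact: integrable_mean_cost.
  exact: icost.
- apply: (@measurable_fun_cvg _ (traj (S * A)%type) R setT
    (fun n w => series (fun t => g ^+ t * mean_cost M (w t)) n)).
    by move=> n; rewrite /series /=; exact: measurable_sum.
  by move=> w _; exact: cvs.
- apply: (@le_lt_trans _ _ (\sum_(0 <= t <oo) (B * g ^+ t)%:E)%E); last first.
    under [X in (limn X < _)%E]eq_fun do rewrite sumEFin.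
    by rewrite -/(series _) EFin_lim // ltry.
  apply: lee_nneseries => t _.
    by move=> _; apply: integral_ge0 => w _; rewrite lee_fin.
  apply: (@le_trans _ _ (\int[traj_law M pi s]_w (B * g ^+ t)%:E)%E).
    apply: ge0_le_integral => //; last by move=> w _; rewrite lee_fin; exact: gB.
    by apply/measurable_EFinP; exact: measurableT_comp.
  by rewrite integral_cst // [X in (_ * X)%E]probability_setT mule1.
- by apply: aeW => w; exact: cvs.
Qed.

End StageCost.

(* Main.v *)
(* Let [T W] be the expected k-step cost of pi_hat with terminal value [W], so
   that [value pi_hat] is a fixed point of [T] by the Markov property. Put
   [e := c2 * eps] and let [d] be the supremum of [value pi_hat - value pi_star].
   Greediness of pi_hat compares it with pi_star on the terminal value [Vhat],
   and replacing a value function by [Vhat], or back, costs [gamma^k * e]. Hence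
   [value pi_hat <= value pi_star + gamma^k * (d + 2 * e)], that is,
   [d <= gamma^k * (d + 2 * e)], so one can take [C = 2 * c2].

   The Markov property is an equality between two finite measures on
   trajectories, the law shifted by k steps conditioned on a prefix and a
   multiple of the law restarted at the current state. It suffices to check it
   on cylinders, where both sides are products of transition probabilities. *)
Require Import Defs.
From HB Require Import structures.
From mathcomp Require Import all_boot all_order all_algebra.
From mathcomp Require Import all_classical all_reals all_analysis measurable_realfun.
From mathcomp Require Import ring lra.

Set Implicit Arguments.
Unset Strict Implicit.
Unset Printing Implicit Defensive.

Import Order.TTheory GRing.Theory Num.Theory.
Import numFieldNormedType.Exports.

Local Open Scope classical_set_scope.
Local Open Scope ring_scope.

(** * Shifting and splicing of trajectories *)

Definition tshift (X : Type) n (w : nat -> X) : nat -> X := fun i => w (n + i)%N.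

Definition splice (X : Type) n (p h : nat -> X) : nat -> X :=
  fun i => if (i < n)%N then p i else h (i - n)%N.

Lemma splice_cylinder (X : Type) n m (p h : nat -> X) :
  cylinder n p `&` tshift n @^-1` cylinder m h = cylinder (n + m) (splice n p h).
Proof.
apply/seteqP; split=> [w [wp wh] i inm|w ww]; rewrite /splice.
  have [/wp //|ni] := ltnP i n.
  by rewrite -wh ?ltn_subLR // /tshift subnKC.
split=> i im.
  by rewrite ww ?(leq_trans im) ?leq_addr // /splice im.
by rewrite /tshift ww ?ltn_add2l // /splice ltnNge leq_addr addKn.
Qed.

(** Countable additivity over the level sets of [f]. The sets [U] and [V] may differ because the
    Markov property compares an event that constrains the future with one that does not. *)
Lemma measure_eq_fibers (R : realType) d (T : measurableType d)
    (m1 m2 : {measure set T -> \bar R}) (f : T -> nat) (U V : set T) :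
  (forall n, measurable (f @^-1` [set n])) -> measurable U -> measurable V ->
  (forall n, m1 (f @^-1` [set n] `&` U) = m2 (f @^-1` [set n] `&` V)) ->
  m1 U = m2 V.
Proof.
move=> mf mU mV E.
have dec W : W = \bigcup_n (f @^-1` [set n] `&` W).
  by apply/seteqP; split=> [w Ww|w [n _ []]//]; exists (f w).
have tr W : trivIset setT (fun n => f @^-1` [set n] `&` W).
  by move=> i j _ _ [w [[/= <- _] [/= <- _]]].
rewrite (dec U) (dec V) !measure_bigcup //.
- by apply: eq_eseriesr => n _; exact: E.
- by move=> i _; exact: measurableI.
- by move=> i _; exact: measurableI.
Qed.

(** * Measures on trajectory space are determined by cylinders *)

Section TrajMeasurable.
Context d (X : measurableType d).
Hypothesis cX : countable [set: X].

Lemma measurable_cylinder n (h : nat -> X) : measurable (cylinder n h : set (traj X)).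
Proof. by apply: sub_sigma_algebra; exists n, h. Qed.

Lemma measurable_tshift n : measurable_fun [set: traj X] (tshift n : traj X -> traj X).
Proof.
apply: (@measurability _ _ (traj X) (traj X) setT (tshift n) (@cylinders X)) => //.
move=> _ [_ [m [h ->]] <-]; rewrite setTI.
apply: (@measurable_prefix _ X (n + m)) => // w w' ww' wh i im.
by rewrite /tshift -ww' ?ltn_add2l //; exact: wh.
Qed.

(* The cylinders of length 0 are excluded: only the nonempty ones have a
   probability given by the law of a trajectory. *)
Lemma traj_measure_ext (R : realType) (m1 m2 : {measure set (traj X) -> \bar R}) :
  (m1 [set: traj X] < +oo)%E ->
  (forall n h, m1 (cylinder n.+1 h) = m2 (cylinder n.+1 h)) ->
  forall B : set (traj X), measurable B -> m1 B = m2 B.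
Proof.
move=> fin1 E; have /countable_injP[e /in2TT ei] := cX.
(* The empty set is included so that [G] is closed under intersection: two cylinders either are
   disjoint or meet in the longer one. The whole space need not lie in [G], so it is covered by the
   countably many sets [g i] that fix the first letter. *)
pose G : set (set (traj X)) := [set C | C = set0 \/ exists n h, C = cylinder n.+1 h].
have Gm : G `<=` measurable.
  by move=> _ [->|[n [h ->]]]; [exact: measurable0|exact: measurable_cylinder].
pose g (i : nat) : set (traj X) := [set w | e (w 0%N) = i].
have Gg i : G (g i).
  have [[x xi]|no] := pselect (exists x, e x = i).
    right; exists 0%N, (fun=> x); apply/seteqP; split=> w /=.
      by move=> wi [|//] _; apply: ei; rewrite xi.
    by rewrite /g /= => ->.
  by left; apply/seteqP; split=> w //= h; apply: no; exists (w 0%N).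
have cover : \bigcup_k g k = setT.
  by apply/seteqP; split=> w // _; exists (e (w 0%N)).
have GI : setI_closed G.
  move=> C D GC GD.
  have [[w [Cw Dw]]|no] := pselect (exists w, C w /\ D w); last first.
    by left; apply/seteqP; split=> w // -[Cw Dw]; apply: no; exists w.
  case: GC GD Cw Dw => [->//|[n [h ->]]] [->//|[m [h' ->]]] nw mw.
  right; exists (maxn n m), w; apply/seteqP; split=> [w' [nw' mw'] i|w' ww'].
    rewrite -maxnSS leq_max => /orP[ii|ii]; first by rewrite nw' ?nw.
    by rewrite mw' ?mw.
  by split=> i ii; [rewrite -nw // ww'|rewrite -mw // ww'] => //;
    rewrite -maxnSS leq_max ii ?orbT.
have EG C : G C -> m1 C = m2 C by move=> [->|[n [h ->]]//]; rewrite !measure0.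
move=> B mB; apply: (g_sigma_algebra_measure_unique G Gm g Gg cover m1 m2 GI EG).
  move=> k; apply: le_lt_trans fin1; apply: le_measure; rewrite ?inE //; exact: Gm.
move: B mB; apply: smallest_sub; first exact: smallest_sigma_algebra.
move=> _ [[|n] [h ->]]; last by apply: sub_sigma_algebra; right; exists n, h.
rewrite (_ : cylinder 0 h = setT); last by apply/seteqP; split.
exact: (@measurableT _ (g_sigma_algebraType G)).
Qed.

End TrajMeasurable.

(** * The Markov property of the trajectory law *)

Section Markov.
Context (R : realType) dS (S : measurableType dS) dA (A : measurableType dA).
Variables (M : mdp R S A) (pi : policy R S A).
Local Notation X := (S * A)%type.
Local Notation mu := (traj_law M pi).

Let cX : countable [set: X] := countable_SA M.

Lemma traj_law_cylinderS s n (h : nat -> X) :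
  mu s (cylinder n.+2 h) =
  (mu s (cylinder n.+1 h) * (transition M (h n).1 (h n).2 [set (h n.+1).1] *
                             pi (h n.+1).1 [set (h n.+1).2]))%E.
Proof. by rewrite !(traj_lawP M pi s) big_ord_recr /= muleA. Qed.

(** The weight [a x] is the mass of the prefix times the probability of moving to [x] next, or the
    Dirac mass at [s] when the prefix is empty. It depends on the state alone, since the action at
    time [n] is drawn by [pi] in both laws. Every further letter multiplies both sides by the same
    factor. *)
Lemma traj_law_splice s n (p : nat -> X) : exists a : S -> {nonneg R},
  (n = 0%N -> (a s)%:num = 1) /\ forall m (h : nat -> X),
  mu s (cylinder n p `&` tshift n @^-1` cylinder m.+1 h) =
  ((a (h 0%N).1)%:num%:E * mu (h 0%N).1 (cylinder m.+1 h))%E.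
Proof.
have Sd := states_discrete M.
have [a [a1 Ha]] : exists a : S -> {nonneg R}, (n = 0%N -> (a s)%:num = 1) /\
    forall h : nat -> X, mu s (cylinder n.+1 (splice n p h)) =
    ((a (h 0%N).1)%:num%:E * pi (h 0%N).1 [set (h 0%N).2])%E.
  case: n => [|n].
    have d0 x : 0 <= fine (\d_s [set x] : \bar R) by rewrite fine_ge0.
    exists (fun x => NngNum (d0 x)); split=> [_|h] /=.
      by rewrite indicE mem_set.
    rewrite (traj_lawP M pi s) big_ord0 mule1 /= /splice /= subnn.
    by rewrite diracE indicE.
  pose q x : \bar R :=
    (mu s (cylinder n.+1 p) * transition M (p n).1 (p n).2 [set x])%E.
  have fq x : q x \is a fin_num.
    by rewrite fin_numM // fin_num_measure //; exact: measurable_cylinder.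
  have q0 x : 0 <= fine (q x) by rewrite fine_ge0 // mule_ge0.
  exists (fun x => NngNum (q0 x)); split=> // h /=; rewrite fineK //.
  rewrite traj_law_cylinderS muleA /splice ltnS leqnn ltnn subnn.
  congr (mu s _ * _ * _)%E; apply/seteqP.
  by split=> w ww i ii; rewrite ww // ii.
exists a; split=> // m h; rewrite splice_cylinder addnS.
elim: m => [|m IH].
  rewrite addn0 Ha (traj_lawP M pi (h 0%N).1) big_ord0 mule1.
  by rewrite diracE mem_set //= mul1e.
rewrite addnS traj_law_cylinderS IH traj_law_cylinderS muleA.
by rewrite /splice !ltnNge leq_addr -addnS leq_addr /= !addKn !muleA.
Qed.

(** For fixed [x] both sides are finite measures in [B], so [traj_measure_ext] carries
    [traj_law_splice] from cylinders to all measurable sets. *)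
Lemma traj_law_prefix s n (p : nat -> X) : exists a : S -> {nonneg R},
  (n = 0%N -> (a s)%:num = 1) /\ forall x (B : set (traj X)), measurable B ->
  mu s (cylinder n p `&` [set w | (w n).1 = x] `&` tshift n @^-1` B) =
  ((a x)%:num%:E * mu x B)%E.
Proof.
have [a [a1 Ha]] := traj_law_splice s n p; exists a; split=> // x.
have mD : measurable (cylinder n p `&` [set w | (w n).1 = x] : set (traj X)).
  by apply: measurableI; [exact: measurable_cylinder|
     exact: (measurable_at M n [set y | y.1 = x])].
have mS := measurable_tshift cX n.
move=> B mB; rewrite setIC.
unshelve refine (@traj_measure_ext _ X cX R
  (pushforward (mrestr (mu s) mD) (tshift n : traj X -> traj X))
  (mscale (a x) (mu x)) _ _ B mB); rewrite /= ?/pushforward ?/mrestr.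
  exact: mS.
  by rewrite preimage_setT setTI -ge0_fin_numE ?fin_num_measure.
move=> m h; rewrite setIC /mscale /=.
(* If [h] starts in a state other than [x], both sides vanish: the event on the left is
   contradictory, and the law on the right starts at [x]. *)
have [hx|hx] := pselect ((h 0%N).1 = x).
  rewrite -{2 3}hx -Ha; congr (mu s _).
  apply/seteqP; split=> w [] => [[]//|wp ws]; do 2!split => //.
  by have /= := ws 0%N isT; rewrite /tshift addn0 => ->.
rewrite (_ : _ `&` _ = set0) ?measure0; last first.
  apply/seteqP; split=> w // [[_ /= wx] /(_ 0%N isT)].
  by rewrite /tshift addn0 => h0; apply: hx; rewrite -h0.
rewrite (traj_lawP M pi x) diracE memNset ?mul0e ?mule0 //= => xh.
exact: hx.
Qed.

(** This is the empty prefix with [B] the whole space, where the weight at [s] is 1. *)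
Lemma traj_law_start s : mu s [set w | (w 0%N).1 = s] = 1%E.
Proof.
have [a [a1 Ha]] := traj_law_prefix s 0 (fun=> point).
have := Ha s setT measurableT; rewrite a1 // mul1e probability_setT => <-.
by congr (mu s _); apply/seteqP; split=> w //= [[]].
Qed.

(** Sum of [traj_law_prefix] over the countably many prefixes of length [n], which [code]
    numbers. *)
Lemma markov_property s n x (B : set (traj X)) : measurable B ->
  mu s ([set w | (w n).1 = x] `&` tshift n @^-1` B) =
  (mu s [set w | (w n).1 = x] * mu x B)%E.
Proof.
move=> mB; have /countable_injP[e /in2TT ei] := cX.
have mN : measurable ([set w | (w n).1 = x] : set (traj X)).
  exact: (measurable_at M n [set y | y.1 = x]).
have mSB : measurable (tshift n @^-1` B : set (traj X)).
  by rewrite -[X in measurable X]setTI; exact: measurable_tshift.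
have r0 : 0 <= fine (mu x B) by rewrite fine_ge0.
have rE : (fine (mu x B))%:E = mu x B by rewrite fineK ?fin_num_measure.
pose code (w : nat -> X) := pickle (map e (mkseq w n)).
have codeP w w' : code w = code w' <-> cylinder n w' w.
  split=> [/(pcan_inj pickleK) /(inj_map ei) E i ni|H].
    by rewrite -(nth_mkseq point w ni) E nth_mkseq.
  rewrite /code; congr (pickle (map e _)); apply/eq_in_map => i.
  by rewrite mem_iota => /andP[_ ?]; exact: H.
have codeE i : code @^-1` [set i] = set0 \/ exists p, code @^-1` [set i] = cylinder n p.
  have [[p pi_]|no] := pselect (exists p, code p = i).
    by right; exists p; apply/seteqP; split=> w /=; rewrite -codeP pi_.
  by left; apply/seteqP; split=> w //= h; apply: no; exists w.
(* As a nonnegative real, [mu x B] can scale [mu s], which turns the right side into a measure of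
   the event at time [n]. *)
rewrite -rE muleC.
apply: (@measure_eq_fibers R _ (traj X) (mu s) (mscale (NngNum r0) (mu s)) code).
- by move=> i; have [->|[p ->]] := codeE i; [exact: measurable0|exact: measurable_cylinder].
- exact: measurableI.
- exact: mN.
move=> i; have [->|[p ->]] := codeE i; first by rewrite !set0I !measure0.
have [a [_ Ha]] := traj_law_prefix s n p.
rewrite setIA; apply: (etrans (Ha x B mB)); rewrite /= /mscale /= rE muleC; congr (_ * _)%E.
(* Taking [B] to be the whole space identifies the weight as the mass of the prefix with state [x]
   at time [n]. *)
have := Ha x setT measurableT; rewrite probability_setT mule1 => <-.
by rewrite preimage_setT setIT.
Qed.

End Markov.

(** * Integrals of bounded functions against a probability *)

Section BoundedIntegral.
Context (R : realType) d (T : measurableType d) (P : probability T R).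

Lemma integrable_bounded (f : T -> R) (K : R) :
  measurable_fun setT f -> (forall x, `|f x| <= K) ->
  P.-integrable setT (EFin \o f).
Proof.
move=> mf fK; apply: measurable_bounded_integrable => //.
  by rewrite -ge0_fin_numE ?fin_num_measure.
exists K; split; first exact: num_real.
by move=> M KM x _ /=; exact: le_trans (fK x) (ltW KM).
Qed.

Lemma Rintegral_cst_probability (c : R) : \int[P]_(x in setT) c = c.
Proof. by rewrite Rintegral_cst // [X in fine X]probability_setT mulr1. Qed.

Lemma Rintegral_leD_cst (f g : T -> R) (c : R) :
  P.-integrable setT (EFin \o f) -> P.-integrable setT (EFin \o g) ->
  (forall x, f x <= g x + c) -> \int[P]_x f x <= \int[P]_x g x + c.
Proof.
move=> intf intg fg; have ic : P.-integrable setT (EFin \o cst c).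
  exact: finite_measure_integrable_cst.
rewrite -[X in _ + X]Rintegral_cst_probability -RintegralD //.
apply: le_Rintegral => //.
exact: (integrableD measurableT intg ic).
Qed.

Lemma Rintegral_norm_le (f : T -> R) (K : R) :
  measurable_fun setT f -> (forall x, `|f x| <= K) -> `|\int[P]_x f x| <= K.
Proof.
move=> mf fK; have intf := integrable_bounded mf fK.
apply: le_trans (le_normr_Rintegral measurableT intf) _.
rewrite -[leRHS]Rintegral_cst_probability; apply: le_Rintegral => //.
- exact: (integrable_norm intf).
- exact: finite_measure_integrable_cst.
Qed.

End BoundedIntegral.

(** * The discounted return along a trajectory *)

Section Return.
Context (R : realType) dS (S : measurableType dS) dA (A : measurableType dA).
Variable M : mdp R S A.
Local Notation X := (S * A)%type.
Local Notation g := (discount M).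

Definition discounted_return (w : nat -> X) : R :=
  limn (series (fun t => g ^+ t * mean_cost M (w t))).

Lemma discounted_cost_bound : exists B : R, forall t x,
  `|g ^+ t * mean_cost M x| <= B * g ^+ t.
Proof.
have [B HB] := mean_cost_bounded M; exists B => t x.
have gt0 : 0 <= g ^+ t by rewrite exprn_ge0 // ltW // discount_gt0.
by rewrite normrM mulrC (ger0_norm gt0) ler_wpM2r //; exact: HB.
Qed.

Lemma is_cvg_geometric_discount (B : R) : cvgn (series (fun t => B * g ^+ t)).
Proof.
apply: is_cvg_geometric_series.
by rewrite ger0_norm ?discount_lt1 // ltW // discount_gt0.
Qed.

Lemma is_cvg_normed_return (w : nat -> X) :
  cvgn [normed series (fun t => g ^+ t * mean_cost M (w t))].
Proof.
have [B HB] := discounted_cost_bound.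
have cvB := @is_cvg_geometric_discount B.
apply: series_le_cvg cvB => t //=.
exact: le_trans (HB t (w t)).
Qed.

Lemma discounted_return_bounded : exists K : R, forall w, `|discounted_return w| <= K.
Proof.
have [B HB] := discounted_cost_bound; exists (limn (series (fun t => B * g ^+ t))) => w.
apply: le_trans (lim_series_norm (@is_cvg_normed_return w)) _.
apply: lim_series_le; [exact: is_cvg_normed_return|exact: is_cvg_geometric_discount|].
by move=> n; exact: HB.
Qed.

Lemma discounted_returnE k (w : nat -> X) :
  discounted_return w = \sum_(0 <= i < k) g ^+ i * mean_cost M (w i)
                        + g ^+ k * discounted_return (tshift k w).
Proof.
have cw v := normed_cvg (@is_cvg_normed_return v).
pose u v := series (fun t => g ^+ t * mean_cost M (v t)).
(* Partial sums of length [n + k] are used, so that the split at [k] is valid for every [n]. *)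
have cl : (fun n => u w (n + k)%N) @ \oo --> discounted_return w.
  by rewrite (cvg_shiftn k (u w)); exact: cw.
have cr : (fun n => \sum_(0 <= i < k) g ^+ i * mean_cost M (w i)
    + g ^+ k * u (tshift k w) n) @ \oo -->
    \sum_(0 <= i < k) g ^+ i * mean_cost M (w i)
    + g ^+ k * discounted_return (tshift k w).
  by apply: cvgD; [exact: cvg_cst|apply: cvgM; [exact: cvg_cst|exact: cw]].
rewrite -(cvg_lim _ cl) // -(cvg_lim _ cr) //; congr (limn _).
apply/funext => n; rewrite /u /series /= (@big_cat_nat _ _ _ k) //= ?leq_addl //.
congr (_ + _); rewrite -{1}[k]add0n big_addn addnK mulr_sumr.
by apply: eq_bigr => i _; rewrite mulrA -exprD addnC.
Qed.

(** Any [f] qualifies, because there are countably many state-action pairs and so every condition on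
    [w t] is measurable. *)
Lemma measurable_fun_at t (f : X -> R) :
  measurable_fun [set: traj X] (fun w : traj X => f (w t)).
Proof.
by move=> _ B mB; rewrite setTI; exact: (measurable_at M t (fun x => B (f x))).
Qed.

Lemma measurable_partial_return n :
  measurable_fun [set: traj X]
    (fun w : traj X => \sum_(0 <= i < n) g ^+ i * mean_cost M (w i)).
Proof.
apply: measurable_sum => i.
exact: (@measurable_fun_at i (fun x => g ^+ i * mean_cost M x)).
Qed.

Lemma measurable_discounted_return :
  measurable_fun [set: traj X] (discounted_return : traj X -> R).
Proof.
apply: (@measurable_fun_cvg _ (traj X) R setT
  (fun n w => series (fun t => g ^+ t * mean_cost M (w t)) n)).
  exact: measurable_partial_return.
by move=> w _; exact: (normed_cvg (@is_cvg_normed_return w)).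
Qed.

Lemma integrable_partial_return (P : probability (traj X) R) n :
  P.-integrable setT
    (fun w => (\sum_(0 <= i < n) g ^+ i * mean_cost M (w i))%:E).
Proof.
have [B HB] := discounted_cost_bound.
apply: (@integrable_bounded _ _ _ _ _ (\sum_(0 <= i < n) B * g ^+ i)).
  exact: measurable_partial_return.
move=> w; apply: le_trans (ler_norm_sum _ _ _) _; exact: ler_sum.
Qed.

End Return.

(** * The k-step Bellman operator *)

Section Bellman.
Context (R : realType) dS (S : measurableType dS) dA (A : measurableType dA).
Variables (M : mdp R S A) (pi : policy R S A).
Local Notation X := (S * A)%type.
Local Notation g := (discount M).
Local Notation mu := (traj_law M pi).

(** Trajectories are partitioned by their state at time [k]. On each piece the Markov property
    replaces the shifted law by a multiple of the restarted one. *)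
Lemma integral_markov s k (F : traj X -> R) (K : R) :
  measurable_fun setT F -> (forall w, `|F w| <= K) ->
  \int[mu s]_w F (tshift k w) = \int[mu s]_w (\int[mu (w k).1]_w' F w').
Proof.
move=> mF FK; have /countable_injP[e /in2TT ei] := states_countable M.
have mFs : measurable_fun [set: traj X] (F \o tshift k : traj X -> R).
  by apply: (measurableT_comp mF); exact: (measurable_tshift (countable_SA M)).
have mFB B : measurable B -> measurable (F @^-1` B : set (traj X)).
  by move=> mB; rewrite -[X in measurable X]setTI; exact: mF.
pose G n : set (traj X) := [set w | e (w k).1 = n].
have mG n : measurable (G n) by exact: (measurable_at M k (fun x => e x.1 = n)).
have UG : \bigcup_n G n = setT.
  by apply/seteqP; split=> w // _; exists (e (w k).1).
have tG : trivIset setT G by move=> i j _ _ [w []]; rewrite /G /= => <- <-.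
rewrite /Rintegral; congr fine; rewrite -UG !integral_bigcup ?UG //; first last.
- exact: (integrable_bounded _ mFs (fun w => FK _)).
- apply: (@integrable_bounded _ _ (traj X) (mu s) _ K).
    exact: (measurable_fun_at M k (fun x : X => \int[mu x.1]_w' F w')).
  by move=> w; exact: Rintegral_norm_le.
apply: eq_eseriesr => n _.
have [[x xn]|no] := pselect (exists x, e x = n); last first.
  have G0 : G n = set0 by apply/seteqP; split=> w //= h; apply: no; exists (w k).1.
  by rewrite G0 !integral_set0.
have Gx : G n = [set w | (w k).1 = x].
  by apply/seteqP; split=> o; rewrite /G /= -xn; [move/ei|move->].
have mGx : measurable ([set w | (w k).1 = x] : set (traj X)) by rewrite -Gx.
have p0 : 0 <= fine (mu s [set w | (w k).1 = x]) by rewrite fine_ge0.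
pose p := NngNum p0.
have pE : (p%:num)%:E = mu s [set w | (w k).1 = x].
  by rewrite fineK // fin_num_measure.
pose L : {mfun traj X >-> R} := mfun_Sub (mem_set mF).
have iF : (mu x).-integrable setT (EFin \o F) := integrable_bounded (mu x) mF FK.
(* The reference law on the reals is that of [F] under [mu x]; the required product formula is the
   Markov property at preimages under [F]. *)
rewrite Gx (@integral_restricted _ _ _ (mu s) (distribution (mu x) L) _
  (F \o tshift k) p _ _ _ EFin) //.
- rewrite (@integral_distribution _ _ _ _ _ (mu x) L EFin) //.
  rewrite (eq_integral (cst (\int[mu x]_w' F w')%:E)); last first.
    by move=> w; rewrite inE => /= ->.
  rewrite integral_cst // pE muleC; congr (_ * _)%E.
  by rewrite /Rintegral fineK //; exact: integrable_fin_num.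
- move=> B mB; rewrite pE /distribution /pushforward /=.
  by rewrite -markov_property //; exact: mFB.
- exact: (integrable_pushforward mF).
Qed.

(** The operator [T] of the overview, here for an arbitrary policy. *)
Definition kstep (V : S -> R) (k : nat) (s : S) : R :=
  \int[mu s]_w (\sum_(0 <= i < k) g ^+ i * mean_cost M (w i) + g ^+ k * V (w k).1).

Lemma value_bounded : exists K : R, forall s, `|value M pi s| <= K.
Proof.
have [K HK] := discounted_return_bounded M; exists K => s.
exact: (Rintegral_norm_le _ (measurable_discounted_return M)).
Qed.

Lemma integrable_state (P : probability (traj X) R) (V : S -> R) (K : R) k :
  (forall s, `|V s| <= K) -> P.-integrable setT (fun w => (V (w k).1)%:E).
Proof.
move=> VK; apply: (@integrable_bounded _ _ _ _ _ K) => //.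
exact: (measurable_fun_at M k (fun x : X => V x.1)).
Qed.

Lemma integrable_kstep s (V : S -> R) (K : R) k : (forall s, `|V s| <= K) ->
  (mu s).-integrable setT (EFin \o (fun w =>
    \sum_(0 <= i < k) g ^+ i * mean_cost M (w i) + g ^+ k * V (w k).1)).
Proof.
move=> VK.
have i1 := integrable_partial_return M (mu s) k.
have i2 := integrableZl measurableT (g ^+ k) (integrable_state (mu s) k VK).
exact: (integrableD measurableT i1 i2).
Qed.

(** The return splits at time [k], and [integral_markov] turns the expected tail into the value of
    the state reached. *)
Lemma value_kstep k s : value M pi s = kstep (value M pi) k s.
Proof.
have [K HK] := discounted_return_bounded M.
have [K' HK'] := value_bounded.
have mF := measurable_discounted_return M.
have mFs : measurable_fun [set: traj X] (fun w : traj X => discounted_return M (tshift k w)).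
  by apply: (measurableT_comp mF); exact: (measurable_tshift (countable_SA M)).
have iFs : (mu s).-integrable setT (EFin \o (fun w : traj X => discounted_return M (tshift k w))).
  exact: (integrable_bounded _ mFs).
have i1 := integrable_partial_return M (mu s) k.
have iV := integrable_state (mu s) k HK'.
transitivity (\int[mu s]_w (\sum_(0 <= i < k) g ^+ i * mean_cost M (w i)
                        + g ^+ k * discounted_return M (tshift k w))).
  by apply: eq_Rintegral => w _; rewrite -discounted_returnE.
rewrite /kstep !RintegralD //.
- by rewrite RintegralZl // RintegralZl // (integral_markov s k mF HK).
- exact: (integrableZl measurableT (g ^+ k) iV).
- exact: (integrableZl measurableT (g ^+ k) iFs).
Qed.

(** Only the terminal term differs, and it is discounted by [g ^+ k]. The bounds [K] and [L] provide
    integrability. *)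
Lemma kstep_leD (V W : S -> R) (K L e : R) k s :
  (forall x, `|V x| <= K) -> (forall x, `|W x| <= L) ->
  (forall x, V x <= W x + e) -> kstep V k s <= kstep W k s + g ^+ k * e.
Proof.
move=> VK WL VW; apply: Rintegral_leD_cst.
- exact: integrable_kstep VK.
- exact: integrable_kstep WL.
move=> w; rewrite -addrA lerD2l -mulrDr ler_wpM2l //.
by rewrite exprn_ge0 // ltW // discount_gt0.
Qed.

(** The trajectory starts at [s] almost surely, so the subtracted term is constant. Hence minimizing
    the disadvantage amounts to minimizing [kstep V k]. *)
Lemma disadvantageE (V : S -> R) (K : R) k s : (forall x, `|V x| <= K) ->
  disadvantage M pi s V k = kstep V k s - V s.
Proof.
move=> VK; rewrite /disadvantage RintegralB //; first last.
- exact: integrable_state VK.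
- exact: integrable_kstep VK.
congr (_ - _); rewrite -[RHS](Rintegral_cst_probability (mu s)).
congr fine; apply: ae_eq_integral => //.
  apply/measurable_EFinP; exact: (measurable_fun_at M 0 (fun x : X => V x.1)).
have mE : measurable ([set w | (w 0%N).1 = s] : set (traj X)).
  exact: (measurable_at M 0 (fun x => x.1 = s)).
exists (~` [set w | (w 0%N).1 = s]); split.
- exact: measurableC.
- by apply: (etrans (probability_setC _ mE)); rewrite traj_law_start subee.
- by move=> w /=; apply: contra_not => -> _.
Qed.

End Bellman.

(** * From the self-bound to the performance gap *)

(* The hypothesis applied with [d] the supremum of [f] yields
   [sup f <= a * sup f + b]. *)
Lemma affine_self_bound (R : realType) (T : pointedType) (f : T -> R) (a b K : R) :
  a < 1 -> (forall x, f x <= K) ->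
  (forall d, (forall x, f x <= d) -> forall x, f x <= a * d + b) ->
  forall x, f x <= b / (1 - a).
Proof.
move=> a1 fK H x.
have ub : has_sup (range f).
  by split; [exists (f point), point|exists K => _ [y _ <-]].
have fs y : f y <= sup (range f) by apply: sup_upper_bound => //; exists y.
apply: le_trans (fs x) _; rewrite ler_pdivlMr ?subr_gt0 // mulrBr mulr1.
rewrite lerBlDl [_ * a]mulrC; apply: ge_sup; first by exists (f point), point.
by move=> _ [y _ <-]; apply: H.
Qed.

Lemma integrable_value (R : realType) dS (S : measurableType dS)
    dA (A : measurableType dA) (M : mdp R S A) (v : probability S R)
    (pi : policy R S A) : v.-integrable setT (EFin \o value M pi).
Proof.
have [K HK] := value_bounded M pi.
by apply: integrable_bounded HK => _ B _; exact: (states_discrete M).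
Qed.

Lemma greedy_value_gap (R : realType) dS (S : measurableType dS)
    dA (A : measurableType dA) (M : mdp R S A) (pi_star pi_hat : policy R S A)
    (V : S -> R) (e : R) (k : nat) :
  (0 < k)%N -> (forall s, `|V s - value M pi_star s| <= e) ->
  minimizes_disadvantage M V k pi_hat ->
  forall s, value M pi_hat s <=
    value M pi_star s + discount M ^+ k / (1 - discount M ^+ k) * (2 * e).
Proof.
move=> k0 Ve greedy; set g := discount M.
have [K HK] := value_bounded M pi_star; have [K' HK'] := value_bounded M pi_hat.
have gk1 : g ^+ k < 1.
  by rewrite exprn_ilt1 ?discount_lt1 -?lt0n // ltW // discount_gt0.
have VK s : `|V s| <= e + K.
  rewrite -[V s](subrK (value M pi_star s)); apply: le_trans (ler_normD _ _) _.
  exact: lerD.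
have V_le s : V s <= value M pi_star s + e.
  by have := Ve s; rewrite ler_norml => /andP[_]; rewrite lerBlDl.
have V_ge s : value M pi_star s <= V s + e.
  by have := Ve s; rewrite ler_norml => /andP[]; rewrite lerNl opprB lerBlDl.
(* This is the shape of [affine_self_bound] for the gap between the two values, with [a] equal to
   [g ^+ k] and [b] to [g ^+ k * (2 * e)]. *)
move=> s; rewrite -lerBlDl mulrAC; move: s.
apply: (@affine_self_bound _ _ _ _ _ (K' + K)) => // [s|d Hd s].
  by apply: le_trans (ler_norm _) _; apply: le_trans (ler_normB _ _) _; exact: lerD.
have step1 : value M pi_hat s <= kstep M pi_hat V k s + g ^+ k * (d + e).
  rewrite (value_kstep _ _ k); apply: kstep_leD HK' VK _ => x.
  by have := Hd x; have := V_ge x; lra.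
have step2 : kstep M pi_hat V k s <= kstep M pi_star V k s.
  by have := greedy pi_star s; rewrite !(disadvantageE _ _ _ _ VK) lerD2r.
have step3 : kstep M pi_star V k s <= value M pi_star s + g ^+ k * e.
  by rewrite [in leRHS](value_kstep _ _ k); exact: kstep_leD VK HK V_le.
lra.
Qed.

Theorem theorem3p2 (R : realType) (c1 c2 : R) (c1_gt0 : 0 < c1) (c1_le_c2 : c1 <= c2) :
  exists C : R, 0 < C /\
    forall (dS : measure_display) (S : measurableType dS)
           (dA : measure_display) (A : measurableType dA)
           (M : mdp R S A) (v : probability S R) (pi_star : policy R S A)
           (eps : R) (Vhat : S -> R) (k : nat) (pi_hat : policy R S A),
      optimal_policy M pi_star ->
      0 < eps ->
      (forall s : S,
         c1 * eps <= `|Vhat s - value M pi_star s| <= c2 * eps) ->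
      (1 < k)%N ->
      minimizes_disadvantage M Vhat k pi_hat ->
      performance M v pi_hat - performance M v pi_star
        <= C * (discount M ^+ k / (1 - discount M ^+ k)) * eps.
Proof.
exists (2 * c2); split; first by rewrite mulr_gt0 // (lt_le_trans c1_gt0).
move=> dS S dA A M v pi_star eps Vhat k pi_hat _ _ Vhat_eps k1 greedy.
have -> : 2 * c2 * (discount M ^+ k / (1 - discount M ^+ k)) * eps =
    discount M ^+ k / (1 - discount M ^+ k) * (2 * (c2 * eps)) by ring.
(* The bound is uniform in the starting state, so it survives averaging over [v]. *)
rewrite lerBlDl; apply: Rintegral_leD_cst; [exact: integrable_value..|].
apply: (greedy_value_gap (ltnW k1) _ greedy) => s.
by case/andP: (Vhat_eps s).
Qed.
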